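(* Let $P=(Z,<)$ be a causal set, and equip $\Omega^P$ with the metric $d(x_1x_2\cdots, y_1y_2\cdots)=\sum_{i=1}^\infty 2^{-i}\,\mathbb{1}(x_i\neq y_i)$. Then the metric space $(\Omega^P,d)$ is compact if and only if, for every stem $A$ of $P$, the poset $P\setminus A$ has only finitely many minimal elements.
   Context: A causal set is a partially ordered set $P=(Z,<)$ with $Z$ countably infinite such that $D(z)=\{y\in Z: y<z\}$ is finite for every $z\in Z$. A down-set is a subset $Y\subseteq Z$ such that $a\in Y$ and $b<a$ imply $b\in Y$; a stem is a finite down-set. For $W\subseteq Z$, $P\setminus W$ denotes the restriction of $P$ to $Z\setminus W$. $\Omega^P$ is the set of infinite strings $\omega=x_1x_2\cdots$ of elements of $Z$ such that, for each $k\ge 1$, $x_k$ is a minimal element of $P\setminus\{x_1,\dots,x_{k-1}\}$. *)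

(* Defs.v *)
From HB Require Import structures.
From mathcomp Require Import all_boot all_order all_algebra.
From mathcomp Require Import all_classical all_reals all_analysis.

Set Implicit Arguments.
Unset Strict Implicit.
Unset Printing Implicit Defensive.
Import Order.TTheory GRing.Theory Num.Theory.
Import numFieldNormedType.Exports.
Local Open Scope classical_set_scope.
Local Open Scope ring_scope.

Section poset.
Context {disp : Order.disp_t} (Z : porderType disp).
Implicit Types (A S : set Z) (w : nat -> Z).

Definition causal_set : Prop :=
  [/\ countable [set: Z], infinite_set [set: Z] &
      forall z : Z, finite_set [set y | (y < z)%O]].

Definition down_set A : Prop := forall a b, A a -> (b < a)%O -> A b.

Definition stem A : Prop := finite_set A /\ down_set A.

(* The minimal elements of the restriction of Z to S; the restriction that
   removes W is the case S = ~` W. *)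
Definition minimal_elements S : set Z :=
  [set x | S x /\ forall y, S y -> ~ (y < x)%O].

(* Strings are indexed from 0: the letter x_k, k >= 1, is w k.-1. *)
Definition extension_strings : set (nat -> Z) :=
  [set w | forall k, minimal_elements (~` (w @` `I_k)) (w k)].

End poset.

Arguments causal_set {disp} Z.
Arguments extension_strings {disp} Z.

(* The parameter R, the type of the reals in which distances are measured, is
   not used in the carrier; it lets the topology, whose type does not mention
   the reals, be inferred from the metric. *)
Definition Omega (R : realType) (disp : Order.disp_t) (Z : porderType disp)
  : Type := set_type (extension_strings Z).

Section Omega_metric.
Context {R : realType} {disp : Order.disp_t} {Z : porderType disp}.

HB.instance Definition _ :=
  Choice.copy (Omega R Z) (set_type (extension_strings Z)).

Implicit Types x y z : Omega R Z.

(* The term of index i, counted from 0, carries the weight 2 ^- i.+1. *)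
Definition dist_terms x y : nat -> R :=
  fun i => 2 ^- i.+1 * (sval x i != sval y i)%:R.

Definition Omega_dist x y : R := limn (series (dist_terms x y)).

Let term_ge0 x y i : 0 <= dist_terms x y i.
Proof. by rewrite mulr_ge0 ?ler0n// invr_ge0 exprn_ge0. Qed.

Lemma is_cvg_dist x y : cvgn (series (dist_terms x y)).
Proof.
apply: (@series_le_cvg R _ (geometric 2^-1 2^-1)) => //.
- by move=> n /=; rewrite mulr_ge0 ?exprn_ge0// invr_ge0.
- move=> n /=; rewrite /dist_terms -exprVn -exprS.
  rewrite -[leRHS]mulr1; apply: ler_wpM2l; last by rewrite lern1 leq_b1.
  by rewrite exprn_ge0// invr_ge0.
- apply: is_cvg_geometric_series.
  by rewrite ger0_norm ?invr_ge0// invf_lt1// ltr1n.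
Qed.

Let Omega_distxx x : Omega_dist x x = 0.
Proof.
rewrite /Omega_dist (_ : series _ = fun=> 0) ?lim_cst//.
apply/funext => n; rewrite /series/= big1// => i _.
by rewrite /dist_terms eqxx mulr0.
Qed.

Let Omega_dist_eq0 x y : Omega_dist x y = 0 -> x = y.
Proof.
move=> d0; apply: val_inj; apply/funext => i /=.
apply/eqP; apply: contraPT d0 => xyi; apply/eqP; rewrite gt_eqF//.
have nd : nondecreasing_seq (series (dist_terms x y)).
  by apply: nondecreasing_series => n _ _; exact: term_ge0.
have := nondecreasing_cvgn_le nd (@is_cvg_dist x y) i.+1.
apply: lt_le_trans; rewrite /series/= big_nat_recr//= ltr_wpDl//.
  by rewrite sumr_ge0.
by rewrite /dist_terms xyi mulr1 invr_gt0 exprn_gt0.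
Qed.

Let Omega_dist_sym x y : Omega_dist x y = Omega_dist y x.
Proof.
rewrite /Omega_dist; congr (limn (series _)).
by apply/funext => i; rewrite /dist_terms eq_sym.
Qed.

Let Omega_dist_triangle y x z :
  Omega_dist x z <= Omega_dist x y + Omega_dist y z.
Proof.
rewrite /Omega_dist -lim_seriesD; try exact: is_cvg_dist.
apply: lim_series_le; [exact: is_cvg_dist| |move=> n].
  by apply: is_cvg_seriesD; exact: is_cvg_dist.
rewrite [leRHS]/GRing.add/= /dist_terms -mulrDr.
apply: ler_wpM2l; first by rewrite invr_ge0 exprn_ge0.
rewrite -natrD ler_nat.
case: (sval x n =P sval z n) => //= xz.
case: (sval x n =P sval y n) => //= xy.
by case: (sval y n =P sval z n) => //= yz; case: xz; rewrite xy.
Qed.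

HB.instance Definition _ := @isMetric.Build R (Omega R Z) Omega_dist
  Omega_distxx Omega_dist_eq0 Omega_dist_sym Omega_dist_triangle.

Lemma Omega_mdistE x y : mdist x y = Omega_dist x y.
Proof. by []. Qed.

End Omega_metric.

(* Main.v *)
(* The metric topology on strings is that of agreement on long prefixes. If all
   the sets of minimal elements are finite, each prefix has finitely many
   continuations by one letter, and compactness is Koenig's lemma, in the form
   of convergence of ultrafilters. Conversely, if A is a stem with n elements,
   every minimal element of the complement of A is the letter of index n of some
   string; as reading this letter is locally constant, it takes only finitely
   many values when the space is compact. *)

Require Import Defs.
From mathcomp Require Import all_boot all_order all_algebra.
From mathcomp Require Import all_classical all_reals all_analysis.
From mathcomp Require Import finmap.
Local Open Scope classical_set_scope.
Local Open Scope card_scope.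

Set Implicit Arguments.
Unset Strict Implicit.
Unset Printing Implicit Defensive.

Import Order.TTheory GRing.Theory Num.Theory.

(** * Compactness, ultrafilters and finite sets *)

(* The sets whose complement has finite image form a filter, and a cluster
   point of it would have a neighbourhood on which [f] is constant. *)
Lemma locally_constant_finite_range (X : topologicalType) (T : Type)
    (f : X -> T) :
  compact [set: X] -> (forall x, \forall y \near x, f y = f x) ->
  finite_set (range f).
Proof.
move=> cX fc; apply: contrapT => ninf.
pose F := [set U : set X | finite_set (f @` (~` U))].
have FF : ProperFilter F.
  split; first by rewrite /F/= setC0.
  split; rewrite /F/=.
  - by rewrite setCT image_set0.
  - by move=> P Q fP fQ; rewrite /= classical_sets.setCI image_setU finite_setU.
  - move=> P Q PQ; apply: sub_finite_set; apply: image_subset.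
    exact: subsetC.
have [p [_ Fp]] := cX F FF filterT.
have [] := Fp [set x | f x <> f p] [set x | f x = f p].
- apply: (@sub_finite_set _ _ [set f p]); last exact: finite_set1.
  by move=> _ [x /contrapT fx <-].
- exact: fc.
by move=> x [].
Qed.

(** An ultrafilter containing no [f m] would contain all their complements, hence the finite
    intersection of these, which misses [P]. *)
Lemma ultra_finite_cover (X : Type) (T : choiceType) (F : set_system X)
    (M : set T) (f : T -> set X) (P : set X) :
  UltraFilter F -> finite_set M -> F P -> P `<=` \bigcup_(m in M) f m ->
  exists2 m, M m & F (f m).
Proof.
move=> UF finM FP PM; apply: contrapT => nF.
have FC : F (\bigcap_(m in [set` fset_set M]) ~` f m).
  apply: filter_bigI => m; rewrite in_fset_set// => /set_mem Mm.
  have [Ffm|//] := in_ultra_setVsetC (f m) UF.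
  by exfalso; apply: nF; exists m.
have [x [Px Cx]] := filter_ex (filterI FP FC).
have [m Mm fx] := PM _ Px.
by apply: (Cx m) => //; rewrite /= in_fset_set// mem_set.
Qed.

Lemma finite_sub_card_eq (T : choiceType) (A B : set T) n :
  A `<=` B -> A #= `I_n -> B #= `I_n -> A = B.
Proof.
move=> AB An Bn.
have finA : finite_set A by apply/finite_setP; exists n.
have finB : finite_set B by apply/finite_setP; exists n.
apply: fset_set_inj => //; apply/eqP; rewrite eqEfcard; apply/andP; split.
  by rewrite -fset_set_sub.
by rewrite (card_fset_set An) (card_fset_set Bn).
Qed.

(** * Stems, minimal elements and strings *)

Section causal_sets.
Context {disp : Order.disp_t} {Z : porderType disp}.
Implicit Types (A S : set Z) (w : nat -> Z).

(** Descent inside [S]: moving to a smaller element strictly shrinks the set of all elements of [Z]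
    below it, which is finite even when [S] is not. *)
Lemma exists_minimal_element S : causal_set Z -> S !=set0 ->
  minimal_elements S !=set0.
Proof.
move=> [_ _ finD] [s Ss].
have [n] := ubnP #|` fset_set [set y | (y < s)%O]|%fset.
elim: n => // n IHn in s Ss *; rewrite ltnS => sn.
have [[y [Sy ys]]|nS] := pselect (exists y, S y /\ (y < s)%O); last first.
  by exists s; split=> // y Sy ys; apply: nS; exists y.
apply: (IHn y Sy); apply: leq_trans sn; apply: fproper_ltn_card.
rewrite fproperEneq; apply/andP; split; last first.
  by rewrite -fset_set_sub// => z /= zy; exact: lt_trans ys.
apply/eqP => /fset_set_inj DE.
have : [set z | (z < s)%O] y by [].
by rewrite -DE//= ltxx.
Qed.

Lemma stem_complement_minimal A : causal_set Z -> stem A ->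
  minimal_elements (~` A) !=set0.
Proof.
move=> hZ [finA _]; apply: exists_minimal_element => //.
case: hZ => _ infZ _; apply/set0P/negP => /eqP A0; apply: infZ.
by rewrite -[setT]setC0 -A0 setCK.
Qed.

Lemma stem_setU1 A x : stem A -> minimal_elements (~` A) x ->
  stem (A `|` [set x]).
Proof.
move=> [finA dA] [Ax mx]; split; first by rewrite finite_setU.
move=> a b [Aa|->] ba; left; first exact: dA ba.
by apply: contrapT => Ab; exact: (mx b).
Qed.

Lemma stem_set0 : stem (set0 : set Z).
Proof. by split. Qed.

Lemma image_IIS w n : w @` `I_n.+1 = w @` `I_n `|` [set w n].
Proof. by rewrite IIS image_setU image_set1. Qed.

Lemma extension_prefix_stem w n : extension_strings Z w -> stem (w @` `I_n).
Proof.
move=> ww; elim: n => [|n IHn]; first by rewrite II0 image_set0; exact: stem_set0.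
by rewrite image_IIS; apply: stem_setU1.
Qed.

Lemma extension_inj w : extension_strings Z w -> injective w.
Proof.
move=> ww; suff lt_neq i j : (i < j)%N -> w i <> w j.
  move=> i j wij; case: (ltngtP i j) => // ij.
    by case: (lt_neq _ _ ij).
  by case: (lt_neq _ _ ij).
by move=> ij wij; case: (ww j) => + _; apply; exists i.
Qed.

Lemma extension_prefix_card w n : extension_strings Z w -> w @` `I_n #= `I_n.
Proof. by move=> ww; apply: inj_card_eq => i j _ _; exact: extension_inj. Qed.

Lemma greedy_extension (g : set Z -> Z) :
  (forall A, stem A -> minimal_elements (~` A) (g A)) ->
  exists2 w, extension_strings Z w & forall n, w n = g (w @` `I_n).
Proof.
move=> gmin; pose S n := iter n (fun A => A `|` [set g A]) set0.
pose w n := g (S n).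
have wS n : w @` `I_n = S n.
  by elim: n => [|n IHn]; rewrite ?II0 ?image_set0// image_IIS IHn.
exists w => [n|n]; rewrite wS//; apply: (gmin).
elim: n => [|n IHn]; first exact: stem_set0.
by apply: stem_setU1 => //; exact: gmin.
Qed.

(* Greedily choose from [A] as long as [A] is not exhausted, then choose [x]. *)
Lemma extension_through A x n : causal_set Z -> stem A -> A #= `I_n ->
  minimal_elements (~` A) x ->
  exists2 w, extension_strings Z w & w n = x.
Proof.
move=> hZ stA cardA minx.
have /choice[g gP] S : exists y, stem S -> minimal_elements (~` S) y /\
    (A `\` S !=set0 -> A y) /\ (S = A -> y = x).
  have [stS|] := pselect (stem S); last by move=> nS; exists x => /nS.
  have [->|SA] := pselect (S = A).
    by exists x; split=> //; split=> //; rewrite setDv => -[].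
  have [AS0|AS0] := pselect (A `\` S !=set0).
    (* As [A] is a down-set, a minimal element of what remains of [A] is minimal in the whole
       complement of [S]. *)
    have [y [[Ay Sy] ymin]] := exists_minimal_element hZ AS0.
    exists y; split; last by split.
    split=> // z Sz zy; apply: (ymin z) => //; split=> //.
    by case: stA => _ dA; exact: dA zy.
  have [y ymin] := stem_complement_minimal hZ stS.
  by exists y; split=> //; split.
have [w ww wg] := greedy_extension (fun S stS => proj1 (gP S stS)).
exists w => //.
have wA k : (k <= n)%N -> w @` `I_k `<=` A.
  elim: k => [|k IHk] kn; first by rewrite II0 image_set0.
  rewrite image_IIS => _ [/(IHk (ltnW kn))//|->]; rewrite wg.
  have [_ [+ _]] := gP _ (extension_prefix_stem k ww); apply.
  (* Were [A] exhausted after [k < n] letters, it would have only [k] elements. *)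
  apply/set0P/negP => /eqP; rewrite setD_eq0 => Ak.
  have AE : w @` `I_k = A by apply/seteqP; split=> //; exact: IHk (ltnW kn).
  have : `I_k #= `I_n.
    apply: card_eq_trans cardA; rewrite -AE card_eq_sym.
    exact: extension_prefix_card.
  by move=> /card_eq_II kE; rewrite kE ltnn in kn.
have [_ [_ ]] := gP _ (extension_prefix_stem n ww); rewrite -wg; apply.
apply: finite_sub_card_eq cardA; first exact: wA.
exact: extension_prefix_card.
Qed.

End causal_sets.

(** * The metric topology and compactness *)

Section Omega_topology.
Local Open Scope ring_scope.
Context {R : realType} {disp : Order.disp_t} {Z : porderType disp}.
Implicit Types x y : Omega R Z.

Lemma Omega_extension x : extension_strings Z (sval x).
Proof. exact/set_mem/(svalP x). Qed.

Lemma dist_terms_ge0 x y i : 0 <= dist_terms x y i.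
Proof. by rewrite mulr_ge0// invr_ge0 exprn_ge0. Qed.

Lemma Omega_dist_ge x y n : sval x n <> sval y n -> 2 ^- n.+1 <= Omega_dist x y.
Proof.
move=> /eqP xyn.
have nd : nondecreasing_seq (series (dist_terms x y)).
  by apply: nondecreasing_series => m _ _; exact: dist_terms_ge0.
apply: le_trans (nondecreasing_cvgn_le nd (@is_cvg_dist _ _ _ x y) n.+1).
rewrite /series/= big_nat_recr//= {2}/dist_terms xyn mulr1 lerDr.
by apply: sumr_ge0 => i _; exact: dist_terms_ge0.
Qed.

Lemma Omega_dist_le x y n : (forall i, (i < n)%N -> sval x i = sval y i) ->
  Omega_dist x y <= 2 ^- n.
Proof.
move=> xy; apply: limr_le; first exact: is_cvg_dist.
near=> m.
have [k ->] : exists k, m = (n + k)%N.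
  by exists (m - n)%N; rewrite subnKC//; near: m; exact: nbhs_infty_ge.
(* Adding the geometric tail that remains after [n + k] terms makes the bound inductive: each new
   term is at most half of that tail. *)
suff: series (dist_terms x y) (n + k)%N + 2 ^- (n + k)%N <= 2 ^- n.
  by apply: le_trans; rewrite lerDl invr_ge0 exprn_ge0.
elim: k => [|k IHk].
  rewrite addn0 /series/= big_nat big1 ?add0r// => i /andP[_ ni].
  by rewrite /dist_terms xy// eqxx mulr0.
apply: le_trans IHk; rewrite addnS /series/= big_nat_recr//= -addrA lerD2l.
have half : 2 ^- (n + k)%N = 2 ^- (n + k)%N.+1 + 2 ^- (n + k)%N.+1 :> R.
  by rewrite -mulr2n -[RHS]mulr_natl exprS invfM mulrA divff ?mul1r.
rewrite half lerD2r -[leRHS]mulr1; apply: ler_wpM2l; last by rewrite lern1 leq_b1.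
by rewrite invr_ge0 exprn_ge0.
Unshelve. all: by end_near. Qed.

Lemma nbhs_OmegaP x (U : set (Omega R Z)) : nbhs x U <->
  exists n, [set y | forall i, (i < n)%N -> sval y i = sval x i] `<=` U.
Proof.
split=> [/nbhs_ballP[e /= e0 eU]|[n nU]].
  have [n _ /(_ n (leqnn n)) ne] := near_infty_natSinv_expn_lt (PosNum e0).
  exists n => y yx; apply: eU; rewrite ballEmdist/= Omega_mdistE.
  apply: le_lt_trans ne; rewrite div1r; apply: Omega_dist_le => i ni.
  by rewrite yx.
(* A disagreement at some [i < n] alone costs [2 ^- i.+1], which is at least this radius. *)
apply/nbhs_ballP; exists (2 ^- n) => /=; first by rewrite invr_gt0 exprn_gt0.
move=> y; rewrite ballEmdist/= Omega_mdistE => xy; apply: nU => i ni.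
apply: contrapT => /nesym/Omega_dist_ge; apply/negP; rewrite -ltNge.
apply: lt_le_trans xy _; rewrite lef_pV2 ?posrE ?exprn_gt0//.
by rewrite ler_eXn2l ?ltr1n.
Qed.

Lemma Omega_compact_finite_minimal (A : set Z) : causal_set Z ->
  compact [set: Omega R Z] -> stem A -> finite_set (minimal_elements (~` A)).
Proof.
move=> hZ cO stA; have [/finite_setP[n An] _] := stA.
apply: (@sub_finite_set _ _ (range (fun x : Omega R Z => sval x n))).
  move=> a /(extension_through hZ stA An)[w ww <-].
  by exists (exist _ w (mem_set ww)).
apply: locally_constant_finite_range => // x.
by apply/nbhs_OmegaP; exists n.+1 => y; exact.
Qed.

(* In an ultrafilter each letter takes one of finitely many values given the
   previous letters, hence is eventually constant; the limits spell a string. *)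
Lemma finite_minimal_Omega_compact :
  (forall A : set Z, stem A -> finite_set (minimal_elements (~` A))) ->
  compact [set: Omega R Z].
Proof.
move=> finmin; rewrite compact_ultra => F UF _.
have [x0 _] := filter_ex (filterT : F setT).
have pref n : exists z : nat -> Z,
    F [set x | forall i, (i < n)%N -> sval x i = z i].
  elim: n => [|n [z Fz]]; first by exists (sval x0); exact: filterS (filterT : F setT).
  have prefE x : (forall i, (i < n)%N -> sval x i = z i) ->
      sval x @` `I_n = z @` `I_n.
    by move=> xz; apply: eq_imagel => i; exact: xz.
  (* Some actual string starts with this prefix, so its letters form a stem. *)
  have [x1 /prefE x1z] := filter_ex Fz.
  have stz : stem (z @` `I_n).
    by rewrite -x1z; apply: extension_prefix_stem; exact: Omega_extension.
  have [|m _ Fm] := @ultra_finite_cover _ _ _ _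
      (fun m => [set x : Omega R Z | sval x n = m]) _ UF (finmin _ stz) Fz.
    move=> x /prefE xz; exists (sval x n) => //; rewrite -xz.
    exact: Omega_extension.
  exists (fun i => if (i < n)%N then z i else m).
  apply: filterS (filterI Fz Fm) => x [xz xm] i /=.
  by rewrite ltnS leq_eqVlt => /orP[/eqP ->|ni]; rewrite ?ltnn// ni xz.
(* The prefixes found so far may depend on [n]; choosing one letter per index gives a single
   sequence. *)
have /choice[z Fz] n : exists m, F [set x | sval x n = m].
  have [z Fz] := pref n.+1; exists (z n).
  by apply: filterS Fz => x; exact.
have {}pref n : F [set x | forall i, (i < n)%N -> sval x i = z i].
  elim: n => [|n IHn]; first by exact: filterS (filterT : F setT).
  apply: filterS (filterI IHn (Fz n)) => x [xz xn] i.
  by rewrite ltnS leq_eqVlt => /orP[/eqP ->//|]; exact: xz.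
(* The condition at [n] involves only the first [n.+1] letters, which [z] shares with some
   string. *)
have zz : extension_strings Z z.
  move=> n; have [x xz] := filter_ex (pref n.+1).
  rewrite -(xz n)// (_ : z @` `I_n = sval x @` `I_n).
    exact: Omega_extension.
  by apply: eq_imagel => i ni; rewrite xz// ltnS ltnW.
exists (exist _ z (mem_set zz)); split=> // U /nbhs_OmegaP[n nU].
exact: filterS nU (pref n).
Qed.

End Omega_topology.

Theorem theorem3p1 (R : realType) (disp : Order.disp_t) (Z : porderType disp)
    (hZ : causal_set Z) :
  compact [set: Omega R Z] <->
  (forall A : set Z, stem A -> finite_set (minimal_elements (~` A))).
Proof.
split=> [cO A stA|]; first exact: (Omega_compact_finite_minimal hZ cO stA).
exact: finite_minimal_Omega_compact.
Qed.
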